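(* $M_2(\mathbb N)\neq M_3(\mathbb N)$ (as spaces of functions $\mathbb N\to\mathbb C$).
   Context: $\mathbb N=\{0,1,2,\dots\}$ is regarded as an additive semigroup with unit $0$. For an integer $d\ge 1$, $M_d(\mathbb N)$ is the space of all functions $\varphi:\mathbb N\to\mathbb C$ for which there are Hilbert spaces $H_0,H_1,\dots,H_d$ with $H_0=H_d=\mathbb C$ and bounded functions $\xi_i:\mathbb N\to B(H_i,H_{i-1})$ ($1\le i\le d$) such that $$\varphi(t_1+t_2+\cdots+t_d)=\xi_1(t_1)\xi_2(t_2)\cdots\xi_d(t_d)\qquad\text{for all } t_1,\dots,t_d\in\mathbb N,$$ where $B(\mathbb C,\mathbb C)$ is identified with $\mathbb C$. Here $B(H,K)$ denotes the bounded linear operators from $H$ to $K$. *)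

(* Defs.v *)
From HB Require Import structures.
From mathcomp Require Import all_boot all_order all_algebra.
From mathcomp Require Import sesquilinear.
From mathcomp.real_closed Require Import complex.
From mathcomp Require Import all_classical all_reals all_analysis.

Set Implicit Arguments.
Unset Strict Implicit.
Unset Printing Implicit Defensive.

Import Order.TTheory GRing.Theory Num.Theory.
Import numFieldNormedType.Exports.

Local Open Scope ring_scope.
Local Open Scope complex_scope.
Local Open Scope classical_set_scope.

HB.instance Definition _ (R : realType) := NormedModule.copy R[i] (R[i]^o).

Section ComplexComplete.
Variable R : realType.

Lemma complex_cauchy_part (p : {additive R[i] -> R})
    (F : set_system R[i]) :
    (forall z : R[i], `|p z|%:C <= `|z|) ->
  ProperFilter F -> cauchy F -> cauchy ((p : R[i] -> R^o) @ F).
Proof.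
move=> le_p FF /cauchy_ballP cF; apply/cauchy_ballP => e e0.
have e0' : 0 < e%:C :> R[i] by rewrite ltcR.
have [[A B] /= [FA FB] AB] := cF _ e0'.
exists (p @` A, p @` B).
  by split; [apply: filterS FA | apply: filterS FB] => z; exists z.
move=> [_ _] [] /= [z Az <-] [w Bw <-].
have := AB (z, w) (conj Az Bw).
rewrite -!ball_normE /= -raddfB => /(le_lt_trans (le_p _)).
by rewrite ltcR.
Qed.

Lemma complex_complete (F : set_system R[i]) :
  ProperFilter F -> cauchy F -> cvg F.
Proof.
move=> FF cF.
have leRe (z : R[i]) : `|(@complex.Re R) z|%:C <= `|z|.
  exact: normc_ge_Re.
have leIm (z : R[i]) : `|(@complex.Im R) z|%:C <= `|z|.
  case: z => a b /=; rewrite normc_def /= lecR -sqrtr_sqr ler_wsqrtr //.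
  by rewrite lerDr sqr_ge0.
have /cauchy_cvg/cvg_ex[/= a /cvgrPdist_lt ca] :=
  complex_cauchy_part leRe FF cF.
have /cauchy_cvg/cvg_ex[/= b /cvgrPdist_lt cb] :=
  complex_cauchy_part leIm FF cF.
apply/cvg_ex; exists (a +i* b); apply/cvgrPdist_lt => e e0.
have eE : e = (complex.Re e)%:C.
  by case: e e0 => er ei; rewrite ltcE /= => /andP[/eqP -> _].
have e20 : 0 < complex.Re e / 2.
  by rewrite divr_gt0 //; move: e0; rewrite eE ltcR.
have := ca _ e20; have := cb _ e20; rewrite !near_map => nb na.
near=> z.
have za : `|a - complex.Re z| < complex.Re e / 2 by near: z.
have zb : `|b - complex.Im z| < complex.Re e / 2 by near: z.
have -> : (a +i* b) - z =
    (a - complex.Re z)%:C + 'i * (b - complex.Im z)%:C :> R[i].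
  by rewrite (complexE ((a +i* b) - z)) !raddfB.
apply: le_lt_trans (ler_normD _ _) _.
rewrite normrM [`|'i|]normc_def /= expr0n expr1n /= add0r sqrtr1 mul1r.
rewrite eE !normc_def /= expr0n /= !addr0 !sqrtr_sqr.
by rewrite -rmorphD ltcR (splitr (complex.Re e)) ltrD.
Unshelve. all: by end_near. Qed.

HB.instance Definition _ := Uniform_isComplete.Build R[i] complex_complete.
End ComplexComplete.

(* Inner products are linear on the left and conjugate-linear on the right,
   following {dot H for _}. *)
HB.mixin Record CompleteNormedModule_isHilbert (R : realType) H
    of CompleteNormedModule R[i] H := {
  hdot : {dot H for @Num.conj R[i]} ;
  hnormE : forall x : H, `|x| ^+ 2 = hdot x x
}.

#[short(type="hilbertType")]
HB.structure Definition Hilbert (R : realType) :=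
  {H of CompleteNormedModule_isHilbert R H & CompleteNormedModule R[i] H}.

Section ComplexHilbert.
Variable R : realType.

Definition cdot (x y : R[i]) : R[i] := x * Num.conj (y : R[i]).

Lemma cdot_bilinear : bilinear_for *%R (@Num.conj R[i] \; *%R) cdot.
Proof.
split=> [y a u v|x a u v]; rewrite /cdot /=.
  by rewrite mulrDl mulrA.
by rewrite rmorphD rmorphM mulrDr mulrCA.
Qed.

HB.instance Definition _ :=
  @bilinear_isBilinear.Build R[i] R[i] R[i] R[i] _ _ cdot cdot_bilinear.

Lemma cdot_hermitian (x y : R[i]) :
  cdot x y = (-1) ^+ false * Num.conj (cdot y x).
Proof. by rewrite /cdot expr0 mul1r rmorphM /= conjCK mulrC. Qed.

HB.instance Definition _ :=
  @isHermitianSesquilinear.Build R[i] R[i] false Num.conj cdot cdot_hermitian.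

Lemma cdot_gt0 (x : R[i]) : x != 0 -> 0 < cdot x x.
Proof. by move=> x0; rewrite /cdot -normCK exprn_gt0 ?normr_gt0. Qed.

HB.instance Definition _ := @isDotProduct.Build R[i] R[i] cdot cdot_gt0.

Lemma cdot_normE (x : R[i]) : `|x| ^+ 2 = cdot x x.
Proof. exact: normCK. Qed.

HB.instance Definition _ :=
  @CompleteNormedModule_isHilbert.Build R R[i] cdot cdot_normE.

End ComplexHilbert.

Section MSpace.
Variable R : realType.

(* A bounded function nat -> B(H, K), i.e. sup_t ||xi t|| <= M < oo; in
   particular each xi t is a bounded operator. *)
Definition bounded_opfun (H K : hilbertType R)
    (xi : nat -> {linear H -> K}) : Prop :=
  exists M : R, forall t x, `|xi t x| <= M%:C * `|x|.

(* Factors are numbered from 0: xi i is the usual xi_{i+1} : H_{i+1} -> H_i, so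
   that opprod H xi t d = xi_1(t_1) \o ... \o xi_d(t_d). *)
Fixpoint opprod (H : nat -> hilbertType R)
    (xi : forall i, nat -> {linear H i.+1 -> H i}) (t : nat -> nat) (d : nat) :
    H d -> H 0%N :=
  if d is n.+1 then fun x => opprod xi t (xi n (t n) x) else id.

(* Meaningful for d >= 1. Only H 0, ..., H d and xi 0, ..., xi d.-1 matter.
   The casts transport along H_0 = H_d = C, and an operator in B(C, C) is
   identified with its value at 1. *)
Definition Mspace (d : nat) : set (nat -> R[i]) :=
  [set phi | exists (H : nat -> hilbertType R)
                    (e0 : H 0%N = R[i]) (ed : H d = R[i])
                    (xi : forall i, nat -> {linear H i.+1 -> H i}),
     (forall i, (i < d)%N -> bounded_opfun (xi i)) /\
     forall t : nat -> nat,
       phi (\sum_(i < d) t i)%N =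
       ecast X (Hilbert.sort X) e0
         (opprod xi t (ecast X (Hilbert.sort X) (esym ed) (1 : R[i])))].

End MSpace.

Arguments Mspace R d : clear implicits.

(* Main.v *)
Require Import Defs.
From HB Require Import structures.
From mathcomp Require Import all_boot all_order all_algebra.
From mathcomp Require Import sesquilinear cyclic separable cyclotomic.
From mathcomp.real_closed Require Import complex.
From mathcomp Require Import all_classical all_reals all_analysis.
From mathcomp Require Import ring lra zify.

(** A function that lies in M_2(N) but not in M_3(N) is written down
    explicitly:

      phi n = sum over l of  c_l * h (n / u_l) * lambda_l ^ n,
      where h x = x * exp (- x).

    The scales u_l grow super-exponentially.  The indices l are cut into
    blocks 16 ^ j <= l < 16 ^ j.+1, the index l = 0 being put in the block j = 0;
    on the j-th block c_l = 8 ^ (-j) and the lambda_l = omega ^ l run through powers of a primitive root of unity omega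
    of order 16 ^ j.  So c is square summable, although c_l times the order
    16 ^ j equals 2 ^ j, which is unbounded.

    Membership in M_2.  Since h (x + y) = h x * exp (- y) + exp (- x) * h y,
    phi (s + t) is the sum over l of
      h (s / u_l) lambda_l ^ s * c_l exp (- t / u_l) lambda_l ^ t
    and of the same expression with s and t exchanged, that is, an inner
    product in ell2.  The sequence c is in ell2, and the sum over l of
    h (n / u_l) ^ 2 is bounded uniformly in n, because
    h x <= 1 and h x <= 2 (exp (- x / 2) - exp (- x)) make it telescope
    ([sum_bump_le]).  The Hilbert space ell2 is constructed here as the space
    of square summable complex sequences.

    Non-membership in M_3.  If phi (i + t + k) = a_i A_t b_k with bounds
    independent of i, t, k, then for N = 16 ^ j two applications of Parseval's
    identity for the Fourier matrix of order N, one on the b_k and one on the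
    images of their transforms under the A_t, bound
      sum over i, l, k < N of  z ^ (i * l) * w_l * z ^ (l * k) * phi (i + t_l + k)
    by a constant times N ^ 2, for every primitive N-th root of unity z,
    |w_l| <= 1 and t_l ([Mspace3_bound]).  Take z conjugate to omega, t_l the scale
    of index N + l, and w_l = z ^ (l * t_l).  Near n = t_l the term
    of index N + l dominates phi n ([separator_near]), and the phases
    cancel, so that each of the N ^ 3 summands has real part at least
    8 ^ (-j) / 32.  Hence 2 ^ j = N * 8 ^ (-j) would be bounded in j. *)

Set Implicit Arguments.
Unset Strict Implicit.
Unset Printing Implicit Defensive.

Import Order.TTheory GRing.Theory Num.Theory.
Import numFieldNormedType.Exports.

Local Open Scope ring_scope.
Local Open Scope complex_scope.
Local Open Scope classical_set_scope.

(** * Square summable complex sequences *)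

Section ComplexSeq.
Variable R : realType.
Local Notation C := R[i].

Lemma complex_gt0E (e : C) : 0 < e -> 0 < complex.Re e /\ e = (complex.Re e)%:C.
Proof. by case: e => a b; rewrite ltcE /= => /andP[/eqP -> a0]. Qed.

Lemma cvg_real_complex (u : nat -> R) (l : R) :
  u @ \oo --> l -> (fun n => (u n)%:C : C) @ \oo --> (l%:C : C).
Proof.
move=> /cvgrPdist_lt ul; apply/cvgrPdist_lt => e /complex_gt0E[e0 ->].
move: (ul _ e0); apply: filterS => n.
by rewrite -rmorphB normc_def /= expr0n /= addr0 sqrtr_sqr ltcR.
Qed.

Lemma cvg_conj (u : nat -> C) (l : C) :
  u @ \oo --> l -> (fun n => Num.conj (u n)) @ \oo --> Num.conj l.
Proof.
move=> /cvgrPdist_lt ul; apply/cvgrPdist_lt => e e0.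
by move: (ul _ e0); apply: filterS => n; rewrite -rmorphB norm_conjC.
Qed.

(** The squared modulus, as an element of [R]. *)
Definition sqn (z : C) : R := complex.Re z ^+ 2 + complex.Im z ^+ 2.

Lemma sqnE z : (sqn z)%:C = `|z| ^+ 2.
Proof. exact: add_Re2_Im2. Qed.

Lemma sqn_ge0 z : 0 <= sqn z.
Proof. by rewrite addr_ge0 ?sqr_ge0. Qed.

Lemma sqnM z w : sqn (z * w) = sqn z * sqn w.
Proof. by case: z w => [a b] [c d]; rewrite /sqn /= !expr2; ring. Qed.

Lemma sqnD z w : sqn (z + w) <= 2 * sqn z + 2 * sqn w.
Proof.
case: z w => [a b] [c d]; rewrite /sqn /=.
have := sqr_ge0 (a - c); have := sqr_ge0 (b - d); rewrite !expr2; nra.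
Qed.

(** Square summability, by a uniform bound on the partial sums. *)
Definition sq_summable (x : nat -> C) : Prop :=
  exists B : R, forall n, \sum_(k < n) sqn (x k) <= B.

Lemma sq_summable_lin (a : C) (x y : nat -> C) :
  sq_summable x -> sq_summable y -> sq_summable (fun k => a * x k + y k).
Proof.
move=> [B xB] [D yD]; exists (2 * (sqn a * B) + 2 * D) => n.
apply: (@le_trans _ _ (\sum_(k < n) (2 * (sqn a * sqn (x k)) + 2 * sqn (y k)))).
  by apply: ler_sum => k _; rewrite -sqnM sqnD.
rewrite big_split /= -!mulr_sumr; apply: lerD; rewrite ler_pM2l ?ltr0n //.
- by rewrite ler_wpM2l ?sqn_ge0 ?xB.
- exact: yD.
Qed.

Lemma sq_summable_cvg (x : nat -> C) : sq_summable x ->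
  exists s : R,
    [/\ (fun n => \sum_(k < n) `|x k| ^+ 2) @ \oo --> (s%:C : C),
        (forall n, \sum_(k < n) sqn (x k) <= s) &
        (forall B, (forall n, \sum_(k < n) sqn (x k) <= B) -> s <= B)].
Proof.
move=> [B xB]; pose u n := \sum_(k < n) sqn (x k).
have u_nd : nondecreasing_seq u.
  by apply/nondecreasing_seqP => n; rewrite /u big_ord_recr lerDl sqn_ge0.
have ucv : cvgn u.
  by apply: nondecreasing_is_cvgn => //; exists B => _ [n _ <-]; exact: xB.
exists (limn u); split.
- rewrite (_ : (fun n => _) = (fun n => (u n)%:C)).
    exact: cvg_real_complex.
  by apply/funext => n; rewrite /u rmorph_sum /=; apply: eq_bigr => k _; rewrite sqnE.
- by move=> n; apply: nondecreasing_cvgn_le.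
- by move=> D xD; apply: limr_le => //; apply: nearW.
Qed.

Lemma polarization (z w : C) : z * Num.conj w =
  4^-1 * (`|1 * z + w| ^+ 2 - `|(-1) * z + w| ^+ 2
          + 'i%C * (`|(-'i%C) * z + w| ^+ 2 - `|'i%C * z + w| ^+ 2)).
Proof.
have i2 : ('i%C : C) * 'i%C = -1 by rewrite -expr2 sqr_i.
have ci : Num.conj ('i%C : C) = - 'i%C by rewrite complexiE conjCi.
rewrite !normCK !rmorphD !rmorphM !rmorphN /= !conjC1 ci.
move: i2; move: ('i%C : C) (Num.conj z) (Num.conj w) => j z' w' i2.
rewrite [X in 4^-1 * X](_ : _ = 2 * z * w' + 2 * w * z' +
  j * j * (2 * w * z' - 2 * z * w')); last by ring.
by rewrite i2; field.
Qed.

(** Partial sums of the inner product of two sequences. *)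
Definition dotsum (x y : nat -> C) (n : nat) : C :=
  \sum_(k < n) x k * Num.conj (y k).

(** By polarization, convergence reduces to that of four series with
    nonnegative terms. *)
Lemma is_cvg_dotsum (x y : nat -> C) :
  sq_summable x -> sq_summable y -> cvgn (dotsum x y).
Proof.
move=> sx sy; pose f a (n : nat) := \sum_(k < n) `|a * x k + y k| ^+ 2 : C.
have fc a : cvgn (f a).
  have [s [+ _ _]] := sq_summable_cvg (sq_summable_lin a sx sy).
  exact: cvgP.
rewrite (_ : dotsum x y = fun n => 4^-1 * (f 1 n - f (-1) n + 'i%C * (f (-'i%C) n - f 'i%C n))).
  apply: is_cvgMr; apply: is_cvgD; first exact: is_cvgB.
  by apply: is_cvgMr; apply: is_cvgB.
apply/funext => n; rewrite /dotsum /f -!sumrB mulr_sumr -big_split mulr_sumr.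
by apply: eq_bigr => k _; rewrite polarization.
Qed.

Definition ell2_pred : {pred nat -> C} := mem [set x | sq_summable x].

Lemma ell2_predP x : reflect (sq_summable x) (x \in ell2_pred).
Proof. by apply: (iffP idP) => [/set_mem|/mem_set]. Qed.

Lemma ell2_submod_closed : submod_closed ell2_pred.
Proof.
split=> [|a x y /ell2_predP sx /ell2_predP sy]; apply/ell2_predP.
  by exists 0 => n; rewrite big1 // => k _; rewrite /sqn /= !expr0n addr0.
exact: sq_summable_lin.
Qed.

HB.instance Definition _ := GRing.isSubmodClosed.Build _ _ ell2_pred ell2_submod_closed.

(** * The Hilbert space ell2 *)

(** The space of square summable complex sequences, as a subspace of the
    space of all sequences. *)
Record ell2 := Ell2 { ell2_fun :> nat -> C; _ : ell2_fun \in ell2_pred }.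
HB.instance Definition _ := [isSub for ell2_fun].
HB.instance Definition _ := [Choice of ell2 by <:].
HB.instance Definition _ := [SubChoice_isSubLmodule of ell2 by <:].

(** The inner product: linear on the left, conjugate-linear on the right. *)
Definition ell2_dot (x y : ell2) : C := lim (dotsum x y @ \oo).

Lemma ell2P (x : ell2) : sq_summable x.
Proof. by apply/ell2_predP; case: x. Qed.

Lemma cvg_ell2_dot (x y : ell2) : dotsum x y @ \oo --> ell2_dot x y.
Proof. exact: (is_cvg_dotsum (ell2P x) (ell2P y)). Qed.

Lemma ell2_dotP (x y : ell2) l : dotsum x y @ \oo --> l -> ell2_dot x y = l.
Proof. by move=> xyl; apply/cvg_lim. Qed.

Lemma ell2_dot_bilinear : bilinear_for *%R (@Num.conj C \; *%R) ell2_dot.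
Proof.
split=> [y a u v|x a u v] /=; apply: ell2_dotP.
  rewrite (_ : dotsum _ _ = fun n => a * dotsum u y n + dotsum v y n).
    by apply: cvgD; [apply: cvgMr|]; exact: cvg_ell2_dot.
  apply/funext => n; rewrite /dotsum mulr_sumr -big_split /=.
  by apply: eq_bigr => k _; rewrite mulrDl mulrA.
rewrite (_ : dotsum _ _ = fun n => Num.conj a * dotsum x u n + dotsum x v n).
  by apply: cvgD; [apply: cvgMr|]; exact: cvg_ell2_dot.
apply/funext => n; rewrite /dotsum mulr_sumr -big_split /=.
by apply: eq_bigr => k _; rewrite rmorphD rmorphM mulrDr mulrCA.
Qed.

HB.instance Definition _ :=
  @bilinear_isBilinear.Build C ell2 ell2 C _ _ ell2_dot ell2_dot_bilinear.

Lemma ell2_dot_hermitian (x y : ell2) :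
  ell2_dot x y = (-1) ^+ false * Num.conj (ell2_dot y x).
Proof.
rewrite expr0 mul1r; apply: ell2_dotP.
rewrite (_ : dotsum _ _ = fun n => Num.conj (dotsum y x n)).
  by apply: cvg_conj; exact: cvg_ell2_dot.
apply/funext => n; rewrite /dotsum rmorph_sum; apply: eq_bigr => k _.
by rewrite rmorphM /= conjCK mulrC.
Qed.

HB.instance Definition _ :=
  @isHermitianSesquilinear.Build C ell2 false Num.conj ell2_dot ell2_dot_hermitian.

Lemma ell2_dotxx (x : ell2) : exists s : R,
  [/\ ell2_dot x x = s%:C, (forall n, \sum_(k < n) sqn (x k) <= s) &
      (forall B, (forall n, \sum_(k < n) sqn (x k) <= B) -> s <= B)].
Proof.
have [s [xs sub slub]] := sq_summable_cvg (ell2P x).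
exists s; split => //; apply: ell2_dotP.
rewrite (_ : dotsum _ _ = fun n => \sum_(k < n) `|x k| ^+ 2) //.
by apply/funext => n; apply: eq_bigr => k _; rewrite normCK.
Qed.

Lemma ell2_dot_gt0 (x : ell2) : x != 0 -> 0 < ell2_dot x x.
Proof.
have [s [-> sub _]] := ell2_dotxx x; rewrite ltcR => x0.
have s0 : 0 <= s by have := sub 0%N; rewrite big_ord0.
rewrite lt_def s0 andbT; apply: contraNneq x0 => s00.
apply/eqP/val_inj/funext => k /=.
have : \sum_(j < k.+1) sqn (x j) <= 0 by apply: le_trans (sub _) _; rewrite s00.
rewrite big_ord_recr /= => /(le_trans _)xk.
have : sqn (x k) = 0.
  apply/eqP; rewrite eq_le sqn_ge0 andbT; apply: xk.
  by rewrite lerDr sumr_ge0 // => j _; exact: sqn_ge0.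
by move/(congr1 (real_complex R)); rewrite sqnE => /eqP; rewrite expf_eq0 normr_eq0 => /eqP.
Qed.

HB.instance Definition _ := @isDotProduct.Build C ell2 ell2_dot ell2_dot_gt0.

End ComplexSeq.

(** The Cauchy-Schwarz and triangle inequalities hold without any dimension
    assumption. *)
Section CauchySchwarz.
Variables (K : numClosedFieldType) (U : lmodType K).
Variable (form : {dot U for (@Num.conj K)}).
Local Notation "''[' u , v ]" := (form u%R v%R) : ring_scope.
Local Notation "''[' u ]" := '[u, u]%R : ring_scope.

Lemma dot_CauchySchwarz (u v : U) : `|'[u, v]| ^+ 2 <= '[u] * '[v].
Proof.
have [->|v0] := eqVneq v 0; first by rewrite !linear0r normr0 expr0n ?mulr0.
pose a := '[u, v] / '[v].
have ou : '[u - a *: v, v] = 0.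
  by rewrite linearBl linearZl_LR /= divfK ?subrr ?dnorm_eq0.
rewrite -(subrK (a *: v) u); move: (u - a *: v) ou => w wv.
rewrite linearDl /= wv add0r linearZl_LR /= hnormDd /=; last first.
  by rewrite linearZr_LR /= wv mulr0.
rewrite normrM (ger0_norm (dnorm_ge0 _ _)) exprMn expr2 mulrA.
rewrite ler_pM2r ?dnorm_gt0 // dnormZ expr2 lerDr; exact: dnorm_ge0.
Qed.

Lemma dot_triangle (u v : U) :
  sqrtC '[u + v] <= sqrtC '[u] + sqrtC '[v].
Proof.
have CS : `|'[u, v]| <= sqrtC '[u] * sqrtC '[v].
  rewrite -(@ler_pXn2r _ 2) ?nnegrE ?mulr_ge0 ?sqrtC_ge0 ?dnorm_ge0 //.
  by rewrite exprMn !sqrtCK dot_CauchySchwarz.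
rewrite -(@ler_pXn2r _ 2) ?nnegrE ?addr_ge0 ?sqrtC_ge0 ?dnorm_ge0 //.
rewrite sqrrD !sqrtCK dnormD [leRHS]addrAC lerD2l.
have dr : '[u, v] + '[u, v]^* \is Num.real.
  by apply/CrealP; rewrite rmorphD /= conjCK addrC.
apply: le_trans (real_ler_norm dr) _; apply: le_trans (ler_normD _ _) _.
by rewrite norm_conjC mulr2n lerD.
Qed.
End CauchySchwarz.

Section Ell2Norm.
Variable R : realType.
Local Notation C := R[i].
Local Notation ell2 := (ell2 R).

(** The norm takes values in [C], as the scalar field is [C]. *)
Definition ell2_norm (x : ell2) : C := sqrtC (ell2_dot x x).

Lemma ler_ell2_normD (x y : ell2) : ell2_norm (x + y) <= ell2_norm x + ell2_norm y.
Proof. exact: (dot_triangle (@ell2_dot R)). Qed.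

Lemma ell2_normZ (a : C) (x : ell2) : ell2_norm (a *: x) = `|a| * ell2_norm x.
Proof.
rewrite /ell2_norm (dnormZ (@ell2_dot R)) sqrtCM ?nnegrE ?exprn_ge0 ?dnorm_ge0 //.
by rewrite exprCK.
Qed.

Lemma ell2_norm0_eq0 (x : ell2) : ell2_norm x = 0 -> x = 0.
Proof. by move=> /eqP; rewrite sqrtC_eq0 (dnorm_eq0 (@ell2_dot R)) => /eqP. Qed.

HB.instance Definition _ := @Lmodule_isNormed.Build C ell2 ell2_norm
   ler_ell2_normD ell2_normZ ell2_norm0_eq0.

Lemma ell2_normE (x : ell2) : `|x| ^+ 2 = ell2_dot x x.
Proof. exact: sqrtCK. Qed.

Lemma ell2_norm_le (x : ell2) (e : R) : 0 <= e ->
  `|x| <= e%:C <-> forall n, \sum_(k < n) sqn (x k) <= e ^+ 2.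
Proof.
move=> e0; have [s [xs sub slub]] := ell2_dotxx x.
have xE : (`|x| <= e%:C) = (s <= e ^+ 2).
  rewrite -(@ler_pXn2r _ 2) ?nnegrE ?ler0c //.
  by rewrite ell2_normE xs -rmorphXn lecR.
rewrite xE; split => [se n|]; last exact: slub.
exact: le_trans (sub n) se.
Qed.

Lemma norm_coord_le (x : ell2) (k : nat) : `|x k| <= `|x|.
Proof.
have /complex_realP[e xe] : `|x| \is Num.real by rewrite ger0_real.
have e0 : 0 <= e by rewrite -ler0c -xe.
have [/(_ _)h _] := ell2_norm_le x e0.
have := h _ k.+1; rewrite xe lexx => /(_ isT).
rewrite big_ord_recr /= => /(le_trans _)hk.
rewrite -(@ler_pXn2r _ 2) ?nnegrE ?normr_ge0 ?ler0c //.
rewrite -sqnE -rmorphXn lecR; apply: hk.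
by rewrite lerDr sumr_ge0 // => j _; exact: sqn_ge0.
Qed.

Lemma cvg_sqn T (F : set_system T) (FF : Filter F) (f : T -> C) (l : C) :
  f @ F --> l -> (fun t => sqn (f t)) @ F --> sqn l.
Proof.
move=> fl.
have part (p : {additive C -> R}) : (forall z : C, `|p z|%:C <= `|z|) ->
    (fun t => p (f t)) @ F --> p l.
  move=> ple; apply/cvgrPdist_lt => e e0.
  have e0' : 0 < e%:C :> C by rewrite ltcR.
  move/cvgrPdist_lt : fl => /(_ _ e0'); apply: filterS => t.
  by rewrite -raddfB -ltcR; apply: le_lt_trans; exact: ple.
have leIm (z : C) : `|(@complex.Im R) z|%:C <= `|z|.
  case: z => a b /=; rewrite normc_def /= lecR -sqrtr_sqr ler_wsqrtr //.
  by rewrite lerDr sqr_ge0.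
rewrite /sqn; apply: cvgD; under eq_fun do rewrite expr2; rewrite expr2.
  by apply: cvgM; apply: part => z; exact: normc_ge_Re.
by apply: cvgM; apply: part => z; exact: leIm.
Qed.

(** The limit of a Cauchy filter is its coordinatewise limit [a].  The bound
    on the finite sums of [sqn (x k - a k)] passes to the limit in the second
    argument, which gives both membership of [a] and convergence in norm. *)
Lemma ell2_complete (F : set_system ell2) :
  ProperFilter F -> cauchy F -> cvg F.
Proof.
move=> FF /cauchy_ballP cF.
have cauchyk k : cauchy ((fun x : ell2 => x k) @ F).
  apply/cauchy_ballP => e e0; have [[A B] /= [FA FB] AB] := cF _ e0.
  exists ((fun x : ell2 => x k) @` A, (fun x : ell2 => x k) @` B).
    by split; [apply: filterS FA | apply: filterS FB] => z; exists z.
  move=> [_ _] [] /= [z Az <-] [w Bw <-].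
  have := AB (z, w) (conj Az Bw); rewrite -!ball_normE /=.
  by apply: le_lt_trans; exact: (norm_coord_le (z - w) k).
have {cauchyk} /choice[a xa] k : exists l : C, (fun x : ell2 => x k) @ F --> l.
  by have /cauchy_cvg/cvg_ex := cauchyk k.
have near_a (e : R) : 0 < e -> F [set x : ell2 |
    forall n, \sum_(k < n) sqn (x k - a k) <= e ^+ 2].
  move=> e0; have e0' : 0 < e%:C :> C by rewrite ltcR.
  have [[A B] /= [FA FB] AB] := cF _ e0'.
  apply: filterS FA => x Ax n.
  pose g (y : ell2) := \sum_(k < n) sqn (x k - y k).
  have ga : g @ F --> \sum_(k < n) sqn (x k - a k).
    apply: cvg_big => [|k _]; first exact: add_continuous.
    apply: cvg_sqn; apply: cvgB; first exact: cvg_cst.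
    exact: xa.
  rewrite -(cvg_lim _ ga) //; apply: limr_le; first exact: cvgP ga.
  apply: filterS FB => y By.
  have := AB (x, y) (conj Ax By); rewrite -ball_normE /= => /ltW.
  by move/(ell2_norm_le _ (ltW e0)) => /(_ n).
have a_mem : a \in @ell2_pred R.
  have [x xB] := filter_ex (near_a 1 ltr01).
  apply/ell2_predP.
  have sxa : sq_summable (fun k => x k - a k) by exists (1 ^+ 2).
  have := sq_summable_lin (-1) sxa (ell2P x).
  congr (sq_summable _); apply/funext => k; ring.
apply/cvg_ex; exists (Ell2 a_mem); apply/cvgrPdist_le => e /complex_gt0E[e0 ->].
apply: filterS (near_a _ e0) => x xB.
by rewrite distrC; apply/(ell2_norm_le _ (ltW e0)) => n; exact: xB.
Qed.

HB.instance Definition _ := Uniform_isComplete.Build ell2 ell2_complete.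
HB.instance Definition _ :=
  @CompleteNormedModule_isHilbert.Build R ell2 (@ell2_dot R) ell2_normE.
End Ell2Norm.

(** * Factorizations of length two through ell2 *)

Section LengthTwo.
Variable R : realType.
Local Notation C := R[i].
Local Notation ell2 := (ell2 R).

(** The linear form represented by the vector [v]. *)
Definition pairing (v x : ell2) : C := ell2_dot x v.
Lemma pairing_linear v : scalar (pairing v).
Proof. by move=> a x y; rewrite /pairing linearPl. Qed.
HB.instance Definition _ v := GRing.isLinear.Build _ _ _ _ (pairing v) (pairing_linear v).

(** The operator from [C] to ell2 sending [1] to [v]. *)
Definition ket (v : ell2) (a : C) : ell2 := a *: v.
Lemma ket_linear v : linear (ket v).
Proof. by move=> a x y; rewrite /ket scalerDl scalerA. Qed.
HB.instance Definition _ v := GRing.isLinear.Build _ _ _ _ (ket v) (ket_linear v).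

(** The Hilbert spaces [C], ell2, [C] of a factorization of length two; the
    later ones are irrelevant. *)
Definition spaces2 (i : nat) : hilbertType R := if i is 1%N then ell2 else C.

(** The operators of a factorization of length two: linear forms given by [G],
    then vectors given by [F]. *)
Definition maps2 (F G : nat -> ell2) (i : nat) :
    nat -> {linear spaces2 i.+1 -> spaces2 i} :=
  match i with
  | 0%N => fun s => pairing (G s)
  | 1%N => fun t => ket (F t)
  | _ => fun _ => \0
  end.

Lemma norm_ket v a : `|ket v a| = `|v| * `|a|.
Proof. by rewrite /ket normrZ mulrC. Qed.

Lemma norm_pairing_le v x : `|pairing v x| <= `|v| * `|x|.
Proof.
rewrite -(@ler_pXn2r _ 2) ?nnegrE ?mulr_ge0 ?normr_ge0 //.
rewrite exprMn mulrC !ell2_normE; exact: (dot_CauchySchwarz (@ell2_dot R)).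
Qed.

Lemma Mspace2_ell2 (F G : nat -> ell2) (phi : nat -> C) (M : R) :
    (forall n, `|F n| <= M%:C) -> (forall n, `|G n| <= M%:C) ->
    (forall s t, phi (s + t)%N = ell2_dot (F t) (G s)) ->
  Mspace R 2 phi.
Proof.
move=> FM GM phiE.
exists spaces2, erefl, erefl, (maps2 F G); split; last first.
  move=> t; rewrite !big_ord_recl big_ord0 addn0 phiE /=.
  by rewrite /pairing /ket scale1r.
move=> [|[|i]] // _; exists M => t x /=.
  apply: le_trans (norm_pairing_le _ _) _.
  by apply: ler_wpM2r; rewrite ?normr_ge0.
by rewrite norm_ket; apply: ler_wpM2r; rewrite ?normr_ge0.
Qed.
End LengthTwo.

(** * Roots of unity and Parseval's identity *)

Section RootsOfUnity.
Variable C : numClosedFieldType.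

Lemma prim_root_exists (n : nat) : (n > 0)%N -> exists z : C, n.-primitive_root z.
Proof.
pose p : {poly C} := 'X^n - 1; have [r Dp] := closed_field_poly_normal p.
move=> n_gt0; rewrite (monicP _) ?monicXnsubC // scale1r in Dp.
have rn1 : all n.-unity_root r by apply/allP=> z; rewrite -root_prod_XsubC -Dp.
have sz_r : (n < (size r).+1)%N.
  by rewrite -(size_prod_XsubC r id) -Dp size_XnsubC.
have [|z] := hasP (has_prim_root n_gt0 rn1 _ sz_r); last by exists z.
by rewrite -separable_prod_XsubC -Dp separable_Xn_sub_1 // pnatr_eq0 -lt0n.
Qed.

Lemma norm_prim_root (n : nat) (z : C) : n.-primitive_root z -> `|z| = 1.
Proof.
move=> zn; have n0 := prim_order_gt0 zn.
by apply/eqP; rewrite -(@pexpr_eq1 _ _ n) // -normrX prim_expr_order // normr1.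
Qed.

(** Orthogonality of the columns of the Fourier matrix. *)
Lemma fourier_orth (N : nat) (z : C) : N.-primitive_root z ->
  forall l m : 'I_N, \sum_(i < N) z ^+ (i * l) * Num.conj (z ^+ (i * m)) = N%:R *+ (l == m).
Proof.
move=> zN l m; have z1 := norm_prim_root zN.
have zz : z * Num.conj z = 1 by rewrite -normCK z1 expr1n.
have zm k : z ^+ k * Num.conj (z ^+ k) = 1 by rewrite rmorphXn -exprMn zz expr1n.
have [<-|lm] := eqVneq l m.
  under eq_bigr do rewrite zm.
  by rewrite sumr_const card_ord.
rewrite mulr0n; set q := z ^+ l * Num.conj (z ^+ m).
under eq_bigr => i _ do rewrite mulnC exprM mulnC exprM rmorphXn -exprMn -/q.
have q1 : q != 1.
  apply: contra lm => /eqP q1; have : q * z ^+ m = z ^+ l.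
    by rewrite /q mulrAC -mulrA zm mulr1.
  rewrite q1 mul1r => /esym/eqP; rewrite (eq_prim_root_expr zN) !modn_small //.
apply: (mulfI (x := q - 1)); first by rewrite subr_eq0.
rewrite -subrX1 mulr0 /q exprMn -rmorphXn -!exprM ![(_ * N)%N]mulnC !exprM.
by rewrite (prim_expr_order zN) !expr1n /= conjC1 mulr1 subrr.
Qed.
End RootsOfUnity.

Section Parseval.
Variable R : realType.
Local Notation C := R[i].

(** Parseval's identity for Hilbert space valued vectors and a matrix whose
    columns are orthogonal, of squared length [N]. *)
Lemma hilbert_parseval (H : hilbertType R) (N : nat) (U : 'I_N -> 'I_N -> C)
    (y : 'I_N -> H) :
    (forall l m, \sum_i U i l * Num.conj (U i m) = (N%:R *+ (l == m))) ->
  \sum_i `|\sum_l U i l *: y l| ^+ 2 = N%:R * \sum_l `|y l| ^+ 2.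
Proof.
move=> Uorth.
transitivity (\sum_l \sum_m (\sum_i U i l * Num.conj (U i m)) * hdot (y l) (y m)).
  under eq_bigr => i _.
    rewrite hnormE linear_sumlz.
    under eq_bigr => l _.
      rewrite linear_sumr; under eq_bigr => m _ do rewrite linearZl_LR linearZr_LR /= mulrA.
      over.
    over.
  rewrite exchange_big; apply: eq_bigr => l _.
  by rewrite exchange_big; apply: eq_bigr => m _; rewrite mulr_suml.
rewrite mulr_sumr; apply: eq_bigr => l _.
under eq_bigr => m _ do rewrite Uorth.
rewrite (bigD1 l) //= big1 => [|m ml]; first by rewrite eqxx mulr1n addr0 hnormE.
by rewrite eq_sym (negPf ml) mulr0n mul0r.
Qed.

(** * An inequality for factorizations of length three *)

(** The trivial bound on the sum would be of order [N ^ 3] for coefficients of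
    modulus one.  The gain comes from applying Parseval's identity to the sum
    over [k], and then to the sum over [l]. *)
Lemma trilinear_bound (H0 H1 H2 : hilbertType R) (a : nat -> {linear H1 -> H0})
    (A : nat -> {linear H2 -> H1}) (b : nat -> H2) (M : C)
    (N : nat) (U : 'I_N -> 'I_N -> C) (w : 'I_N -> C) (u : 'I_N -> nat) :
    0 <= M -> (forall i x, `|a i x| <= M * `|x|) ->
    (forall i x, `|A i x| <= M * `|x|) -> (forall i, `|b i| <= M) ->
    (forall l m, \sum_i U i l * Num.conj (U i m) = N%:R *+ (l == m)) ->
    (forall l, `|w l| <= 1) ->
  `|\sum_(i < N) \sum_(l < N) \sum_(k < N)
       (U i l * w l * U l k) *: a i (A (u l) (b k))| <= M * (M ^+ 4 + 1) * N%:R ^+ 2.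
Proof.
move=> M0 aM AM bM Uorth w1.
have [N0|N0] := posnP N; first by subst N; rewrite big_ord0 normr0 expr0n mulr0.
have N0' : 0 < N%:R :> C by rewrite ltr0n.
pose B l := \sum_(k < N) U l k *: b k.
pose Y l := w l *: A (u l) (B l).
pose Z i := \sum_l U i l *: Y l.
have -> : \sum_(i < N) \sum_(l < N) \sum_(k < N)
       (U i l * w l * U l k) *: a i (A (u l) (b k)) = \sum_(i < N) a i (Z i).
  apply: eq_bigr => i _; rewrite linear_sum; apply: eq_bigr => l _.
  rewrite linearZ_LR /= /Y linearZ_LR /= scalerA /B linear_sum /= linear_sum /= scaler_sumr.
  by apply: eq_bigr => k _; rewrite linearZ_LR /= linearZ_LR /= scalerA.
have sB : \sum_l `|B l| ^+ 2 <= N%:R ^+ 2 * M ^+ 2.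
  rewrite (hilbert_parseval _ Uorth) expr2 -mulrA ler_pM2l //.
  apply: (@le_trans _ _ (\sum_(i < N) M ^+ 2)).
    by apply: ler_sum => k _; rewrite ler_pXn2r ?nnegrE.
  by rewrite sumr_const card_ord mulr_natl.
have sY : \sum_l `|Y l| ^+ 2 <= N%:R ^+ 2 * M ^+ 4.
  rewrite (_ : 4 = 2 + 2)%N // exprD mulrA.
  apply: le_trans (ler_wpM2r _ sB); last by rewrite exprn_ge0.
  rewrite mulr_suml; apply: ler_sum => l _; rewrite -exprMn ler_pXn2r ?nnegrE ?mulr_ge0 //.
  rewrite /Y normrZ -[leRHS]mul1r; apply: ler_pM => //.
  by rewrite mulrC; exact: AM.
have sZ : \sum_i `|Z i| ^+ 2 <= N%:R * (N%:R ^+ 2 * M ^+ 4).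
  by rewrite (hilbert_parseval _ Uorth) ler_pM2l.
apply: le_trans (ler_norm_sum _ _ _) _.
apply: (@le_trans _ _ (\sum_(i < N) M * (`|Z i| ^+ 2 / N%:R + N%:R))).
  apply: ler_sum => i _; apply: le_trans (aM _ _) _; apply: ler_wpM2l => //.
  (* |Z i| <= |Z i| ^ 2 / N + N, since |Z i| is at most N or at least N *)
  have Zr : `|Z i| \is Num.real by rewrite ger0_real.
  rewrite -(ler_pM2r N0') mulrDl divfK ?gt_eqF // -expr2.
  have [zn|nz] := real_leP Zr (ger0_real (ltW N0')).
    by rewrite -[leLHS]add0r; apply: lerD; rewrite ?exprn_ge0 // expr2 ler_pM2r.
  rewrite -[leLHS]addr0; apply: lerD; rewrite ?exprn_ge0 // expr2.
  by apply: ler_wpM2l => //; exact: ltW.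
rewrite -mulr_sumr -mulrA; apply: ler_wpM2l => //.
rewrite big_split /= -mulr_suml mulrDl mul1r; apply: lerD.
  by rewrite ler_pdivrMr // (le_trans sZ) // mulrC -mulrA mulrCA mulrA.
by rewrite sumr_const card_ord expr2 mulr_natl.
Qed.

(** Transport along an equality of Hilbert spaces is a linear isometry. *)
Lemma norm_ecast (X Y : hilbertType R) (e : X = Y) (x : X) :
  `|ecast Z (Hilbert.sort Z) e x| = `|x|.
Proof. by case: _ / e. Qed.

Lemma ecast_scale (X Y : hilbertType R) (e : X = Y) (c : C) (x : X) :
  ecast Z (Hilbert.sort Z) e (c *: x) = c *: ecast Z (Hilbert.sort Z) e x.
Proof. by case: _ / e. Qed.

Lemma ecast_sum (X Y : hilbertType R) (e : X = Y) (I : Type) (r : seq I)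
    (F : I -> X) :
  ecast Z (Hilbert.sort Z) e (\sum_(i <- r) F i) =
  \sum_(i <- r) ecast Z (Hilbert.sort Z) e (F i).
Proof. by case: _ / e. Qed.

Lemma Mspace3_bound (phi : nat -> C) : Mspace R 3 phi ->
  exists K : R, forall (N : nat) (z : C) (w : 'I_N -> C) (u : 'I_N -> nat),
    N.-primitive_root z -> (forall l, `|w l| <= 1) ->
  `|\sum_(i < N) \sum_(l < N) \sum_(k < N)
     z ^+ (i * l) * w l * z ^+ (l * k) * phi (i + u l + k)%N| <= K%:C * N%:R ^+ 2.
Proof.
case=> H [e0 [e3 [xi [xib phiE]]]].
have [[M1 b1] [M2 b2] [M3 b3]] := And3 (xib 0%N isT) (xib 1%N isT) (xib 2%N isT).
pose M : R := `|M1| + `|M2| + `|M3|.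
have [M1M M2M M3M] : [/\ M1 <= M, M2 <= M & M3 <= M].
  have := ler_norm M1; have := ler_norm M2; have := ler_norm M3.
  have := normr_ge0 M1; have := normr_ge0 M2; have := normr_ge0 M3.
  by rewrite /M; split; lra.
have M0 : 0 <= M%:C :> C by rewrite ler0c /M !addr_ge0.
have weak (x y : R) (X : hilbertType R) (v : X) :
    x <= y -> x%:C * `|v| <= y%:C * `|v|.
  by move=> xy; apply: ler_wpM2r; rewrite ?lecR.
pose one := ecast X (Hilbert.sort X) (esym e3) (1 : C).
have one1 : `|one| = 1 by rewrite norm_ecast normr1.
exists (M * (M ^+ 4 + 1)) => N z w u zN w1.
have -> : (M * (M ^+ 4 + 1))%:C = M%:C * (M%:C ^+ 4 + 1) :> C.
  by rewrite !(rmorphM, rmorphD, rmorphXn, rmorph1).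
pose U (i l : 'I_N) := z ^+ (i * l).
have Uorth l m : \sum_i U i l * Num.conj (U i m) = N%:R *+ (l == m).
  exact: fourier_orth.
have aM i x : `|xi 0%N i x| <= M%:C * `|x|.
  by apply: le_trans (b1 i x) (weak _ _ _ _ M1M).
have AM i x : `|xi 1%N i x| <= M%:C * `|x|.
  by apply: le_trans (b2 i x) (weak _ _ _ _ M2M).
have bM k : `|xi 2%N k one| <= M%:C.
  by apply: le_trans (b3 k one) _; rewrite one1 mulr1 lecR.
apply: le_trans (trilinear_bound u M0 aM AM bM Uorth w1).
rewrite le_eqVlt; apply/orP; left; apply/eqP.
rewrite -(norm_ecast e0) ecast_sum; congr `| _ |.
apply: eq_bigr => i _; rewrite ecast_sum; apply: eq_bigr => l _.
rewrite ecast_sum; apply: eq_bigr => k _; rewrite ecast_scale.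
have := phiE (fun j => nth 0%N [:: nat_of_ord i; u l; nat_of_ord k] j).
by rewrite !big_ord_recl big_ord0 /= addn0 addnA => ->.
Qed.
End Parseval.

(** * A bump function with telescoping sums *)

Section Bump.
Variable R : realType.
Local Notation C := R[i].

(** Its addition formula [bumpD] has two terms, each of which separates the
    variables. *)
Definition bump (x : R) : R := x * expR (- x).

Lemma bump_ge0 x : 0 <= x -> 0 <= bump x.
Proof. by move=> x0; rewrite /bump mulr_ge0 // expR_ge0. Qed.

Lemma bump_le1 x : bump x <= 1.
Proof.
rewrite /bump expRN ler_pdivrMr ?expR_gt0 // mul1r.
by apply: le_trans (expR_ge1Dx x); rewrite lerDr.
Qed.

Lemma bumpD x y : bump (x + y) = bump x * expR (- y) + expR (- x) * bump y.
Proof. by rewrite /bump opprD expRD; ring. Qed.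

Lemma bump_le_diff x : bump x <= 2 * (expR (- (x / 2)) - expR (- x)).
Proof.
have -> : expR (- (x / 2)) = expR (- x) * expR (x / 2).
  by rewrite -expRD; congr expR; field.
have := expR_ge1Dx (x / 2); have := expR_gt0 (- x); rewrite /bump; nra.
Qed.

Lemma bump_ge x : 1 <= x <= 2 -> 16^-1 <= bump x.
Proof.
move=> /andP[x1 x2]; have e2 : 16^-1 <= expR (- x).
  have -> : expR (- x) = expR (- (x / 4)) ^+ 4.
    by rewrite -expRM_natl; congr expR; field.
  have := expR_ge1Dx (- (x / 4)); set e := expR _ => he.
  have -> : 16^-1 = 2^-1 ^+ 4 :> R by field.
  by rewrite ler_pXn2r ?nnegrE ?expR_ge0 //; lra.
by rewrite /bump; have := expR_gt0 (- x); nra.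
Qed.

(** When the scales at least double, the bounds of [bump_le_diff] telescope. *)
Lemma sum_bump_le (u : nat -> R) (y : R) (a b : nat) :
    (forall l, 0 < u l) -> (forall l, 2 * u l <= u l.+1) -> 0 <= y -> (a <= b)%N ->
  \sum_(a <= l < b.+1) bump (y / u l) <=
    2 * (expR (- (y / u b / 2)) - expR (- (y / u a))).
Proof.
move=> u0 u2 y0 /subnK <-; elim: (b - a)%N => [|d IH].
  by rewrite add0n big_nat1 bump_le_diff.
rewrite addSn big_nat_recr /= ?leqW ?leq_addl //.
have := bump_le_diff (y / u (d + a).+1).
have : expR (- (y / u (d + a)%N / 2)) <= expR (- (y / u (d + a).+1)).
  rewrite ler_expR lerN2 -mulrA -invfM; apply: ler_wpM2l => //.
  by rewrite lef_pV2 ?posrE ?mulr_gt0 // mulrC.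
by move: IH; lra.
Qed.
End Bump.

(** * Scales, amplitudes and frequencies *)

Section Scales.
Variable R : realType.
Local Notation C := R[i].

(** The scale u_l.  The ratio of consecutive scales is [256 * l.+2], which is
    large compared with the inverse of the amplitude of index [l]. *)
Definition scale (l : nat) : nat := (256 ^ l * l.+1`!)%N.
(** The [j] such that [16 ^ j <= l < 16 ^ j.+1]; it is [0] for [l = 0]. *)
Definition block (l : nat) : nat := trunc_log 16 l.
(** The amplitude c_l. *)
Definition amp (l : nat) : R := 8^-1 ^+ block l.
(** A chosen primitive root of unity of order [16 ^ j]; the default value [1]
    is not used, by [croot_prim]. *)
Definition croot (j : nat) : C := xget 1 [set z : C | (16 ^ j).-primitive_root z].
(** The frequency lambda_l.  As [l] runs over [16 ^ j] consecutive indices of the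
    [j]-th block, it takes every power of [croot j] once. *)
Definition freq (l : nat) : C := croot (block l) ^+ l.

Lemma scale_gt0 l : 0 < (scale l)%:R :> R.
Proof. by rewrite ltr0n /scale muln_gt0 expn_gt0 fact_gt0. Qed.

Lemma scaleS l : (scale l.+1)%:R = 256 * (l.+2)%:R * (scale l)%:R :> R.
Proof. by rewrite -!natrM /scale factS expnS; congr (_%:R); lia. Qed.

Lemma scale_double l : 2 * (scale l)%:R <= (scale l.+1)%:R :> R.
Proof.
rewrite scaleS ler_pM2r ?scale_gt0 // -[2]mulr1; apply: ler_pM => //.
  by rewrite ler_nat.
by rewrite ler1n.
Qed.

Lemma scale_ge l : (2 * l <= scale l)%N.
Proof.
apply: leq_trans (leq_pmulr _ (fact_gt0 _)).
elim: l => // l IH; rewrite expnS; move: IH; have := expn_gt0 256 l; lia.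
Qed.

Lemma blockE j l : (16 ^ j <= l < 16 ^ j.+1)%N -> block l = j.
Proof. exact: trunc_log_eq. Qed.

Lemma amp_gt0 l : 0 < amp l.
Proof. by rewrite exprn_gt0 // invr_gt0. Qed.

Lemma amp_le1 l : amp l <= 1.
Proof. by rewrite exprn_ile1 ?invr_ge0 // invf_le1 ?ler1n. Qed.

Lemma amp_ge l : (l.+1)%:R^-1 <= amp l.
Proof.
rewrite /amp exprVn lef_pV2 ?posrE ?exprn_gt0 // -natrX ler_nat.
case: l => // l; apply: (@leq_trans l.+1) => //.
apply: leq_trans (@trunc_logP 16 l.+1 isT isT).
by rewrite /block; case: (trunc_log _ _) => // k; rewrite leq_exp2r.
Qed.

(** The [j]-th block contributes [15 * 16 ^ j / 64 ^ j = 15 / 4 ^ j], and the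
    index [0] adds [1]. *)
Lemma sum_amp (n : nat) : \sum_(l < n) amp l ^+ 2 <= 21.
Proof.
have blocks J : \sum_(0 <= l < 16 ^ J) amp l ^+ 2 = 21 - 20 * 4^-1 ^+ J.
  elim: J => [|J IH].
    by rewrite expn0 big_nat1 /amp /block trunc_log0 !expr0; ring.
  rewrite (@big_cat_nat _ _ _ (16 ^ J)) ?leq_exp2l //= IH.
  rewrite (_ : \sum_(16 ^ J <= l < _) _ = \sum_(16 ^ J <= l < 16 ^ J.+1) (64^-1 ^+ J)).
    rewrite sumr_const_nat (_ : 16 ^ J.+1 - 16 ^ J = 16 ^ J * 15)%N; last first.
      by rewrite expnS; lia.
    rewrite mulrnA -[_ *+ (16 ^ J)]mulr_natr natrX -exprMn exprS.
    have -> : 64^-1 * 16 = 4^-1 :> R by field.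
    by rewrite -[_ *+ 15]mulr_natr; field.
  apply: eq_big_nat => l lJ; rewrite /amp (blockE lJ) -exprM mulnC exprM.
  by congr (_ ^+ _); field.
apply: (@le_trans _ _ (\sum_(0 <= l < 16 ^ n) amp l ^+ 2)).
  rewrite -(big_mkord xpredT (fun l => amp l ^+ 2)).
  rewrite (@big_cat_nat _ _ _ n 0 (16 ^ n)) //=; last exact/ltnW/ltn_expl.
  by rewrite lerDl sumr_ge0 // => l _; rewrite sqr_ge0.
by rewrite blocks gerBl mulr_ge0 // exprn_ge0 // invr_ge0.
Qed.

Lemma croot_prim j : (16 ^ j).-primitive_root (croot j).
Proof.
have [z zP] := @prim_root_exists C (16 ^ j) (expn_gt0 16 j).
by rewrite /croot; case: xgetP => // /(_ z).
Qed.

Lemma norm_freq l n : `|freq l ^+ n| = 1.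
Proof. by rewrite !normrX (norm_prim_root (croot_prim _)) !expr1n. Qed.
End Scales.

(** * The separating function *)

Section Separator.
Variable R : realType.
Local Notation C := R[i].
Local Notation ell2 := (ell2 R).
Local Notation u := (fun l => (scale l)%:R : R).

(** The two families of factors of [sep_term], see [sep_termD]. *)
Definition wave (n l : nat) : C := (bump (n%:R / u l))%:C * freq R l ^+ n.
Definition decay (n l : nat) : C :=
  (amp R l * expR (- (n%:R / u l)))%:C * freq R l ^+ n.
(** The [l]-th term of the series defining [separator]. *)
Definition sep_term (n l : nat) : C :=
  (amp R l * bump (n%:R / u l))%:C * freq R l ^+ n.
(** The function which belongs to M_2 but not to M_3; the series converges by
    [cvg_separator]. *)
Definition separator (n : nat) : C :=
  lim ((fun P => \sum_(l < P) sep_term n l) @ \oo).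

Lemma sep_termD s t l :
  sep_term (s + t) l = wave s l * decay t l + decay s l * wave t l.
Proof.
rewrite /sep_term /wave /decay natrD mulrDl bumpD exprD.
rewrite mulrDr rmorphD !rmorphM /=; ring.
Qed.

(** The sequence x 0, y 0, x 1, y 1, and so on; it realizes the direct sum of
    two copies of ell2 inside ell2. *)
Definition interleave (x y : nat -> C) (k : nat) : C :=
  if odd k then y k./2 else x k./2.

Lemma sum_double (V : nmodType) (f : nat -> V) P :
  \sum_(k < P.*2) f k = \sum_(l < P) (f l.*2 + f l.*2.+1).
Proof.
elim: P => [|P IH]; first by rewrite !big_ord0.
by rewrite doubleS !big_ord_recr /= IH addrA.
Qed.

Lemma dotsum_interleave (x y x' y' : nat -> C) P :
  dotsum (interleave x y) (interleave x' y') P.*2 =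
  \sum_(l < P) (x l * Num.conj (x' l) + y l * Num.conj (y' l)).
Proof.
rewrite /dotsum (sum_double (fun k => interleave x y k * Num.conj (interleave x' y' k))).
by apply: eq_bigr => l _; rewrite /interleave /= odd_double uphalf_double doubleK.
Qed.

Lemma sum_sqn_interleave (x y : nat -> C) (B D : R) :
    (forall P, \sum_(l < P) sqn (x l) <= B) ->
    (forall P, \sum_(l < P) sqn (y l) <= D) ->
  forall n, \sum_(k < n) sqn (interleave x y k) <= B + D.
Proof.
move=> xB yD n.
apply: (@le_trans _ _ (\sum_(k < n.*2) sqn (interleave x y k))).
  rewrite -!(big_mkord xpredT (fun k => sqn (interleave x y k))).
  rewrite [leRHS](@big_cat_nat _ _ _ n) //=; last by rewrite -addnn leq_addr.
  by rewrite lerDl sumr_ge0 // => k _; exact: sqn_ge0.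
rewrite (sum_double (fun k => sqn (interleave x y k))) big_split /=.
apply: lerD; [apply: le_trans (xB n) | apply: le_trans (yD n)];
  by apply: ler_sum => l _; rewrite /interleave /= odd_double ?uphalf_double ?doubleK.
Qed.

Lemma sqn_real_freq (r : R) l n : sqn (r%:C * freq R l ^+ n) = r ^+ 2.
Proof.
apply: (@complexI R); rewrite sqnE normrM norm_freq mulr1 rmorphXn /=.
by apply/real_normK/complex_realP; exists r.
Qed.

Lemma sqn_conj (z : C) : sqn (Num.conj z) = sqn z.
Proof. by apply: (@complexI R); rewrite !sqnE norm_conjC. Qed.

Lemma sum_bump_le2 n a P : \sum_(a <= l < P) bump (n%:R / u l) <= 2.
Proof.
have [aP|Pa] := ltnP a P; last by rewrite big_geq.
case: P aP => // P aP.
apply: le_trans (@sum_bump_le R u n%:R a P (@scale_gt0 R) (@scale_double R) _ aP) _ => //.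
by rewrite -[leRHS]mulr1 ler_pM2l // lerBlDr.
Qed.

Lemma sum_sqn_wave n P : \sum_(l < P) sqn (wave n l) <= 2.
Proof.
apply: le_trans (sum_bump_le2 n 0 P); rewrite big_mkord; apply: ler_sum => l _.
by rewrite sqn_real_freq expr2 ler_piMr ?bump_le1 // bump_ge0 // divr_ge0 //.
Qed.

Lemma sum_sqn_decay n P : \sum_(l < P) sqn (decay n l) <= 21.
Proof.
apply: le_trans (sum_amp R P); apply: ler_sum => l _.
by rewrite sqn_real_freq exprMn ler_piMr ?sqr_ge0 // exprn_ile1 ?expR_ge0 //.
Qed.

Lemma sum_sqn_F n P : \sum_(k < P) sqn (interleave (wave n) (decay n) k) <= 5 ^+ 2.
Proof.
apply: le_trans (sum_sqn_interleave (sum_sqn_wave n) (sum_sqn_decay n) P) _.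
by rewrite -natrD -natrX ler_nat.
Qed.

Lemma sum_sqn_G n P : \sum_(k < P) sqn (interleave (fun l => Num.conj (decay n l))
   (fun l => Num.conj (wave n l)) k) <= 5 ^+ 2.
Proof.
apply: le_trans (@sum_sqn_interleave _ _ 21 2 _ _ P) _ => [Q|Q|].
- by under eq_bigr do rewrite sqn_conj; exact: sum_sqn_decay.
- by under eq_bigr do rewrite sqn_conj; exact: sum_sqn_wave.
- by rewrite -natrD -natrX ler_nat.
Qed.

Lemma mem_ell2 (x : nat -> C) (B : R) :
  (forall P, \sum_(k < P) sqn (x k) <= B) -> x \in @ell2_pred R.
Proof. by move=> xB; apply/ell2_predP; exists B. Qed.

(** The vectors whose inner products are the values of [separator], see
    [separatorD]. *)
Definition left_vec (n : nat) : ell2 := Ell2 (mem_ell2 (sum_sqn_F n)).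
Definition right_vec (n : nat) : ell2 := Ell2 (mem_ell2 (sum_sqn_G n)).

Lemma cvg_separatorD s t :
  (fun P => \sum_(l < P) sep_term (s + t) l) @ \oo -->
  ell2_dot (left_vec t) (right_vec s).
Proof.
have -> : (fun P => \sum_(l < P) sep_term (s + t) l) =
   (dotsum (left_vec t) (right_vec s)) \o double.
  apply/funext => P; rewrite /= dotsum_interleave; apply: eq_bigr => l _.
  by rewrite !conjCK addnC sep_termD.
apply: (@cvg_comp _ _ _ _ (dotsum (left_vec t) (right_vec s)) \oo \oo).
  by apply/cvgnyPge => A; near=> n; rewrite -addnn; apply: leq_trans (leq_addr _ _);
    near: n; exact: nbhs_infty_ge.
exact: cvg_ell2_dot.
Unshelve. all: by end_near. Qed.

Lemma separatorD s t : separator (s + t) = ell2_dot (left_vec t) (right_vec s).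
Proof. by apply/cvg_lim => //; exact: cvg_separatorD. Qed.

Lemma cvg_separator n :
  (fun P => \sum_(l < P) sep_term n l) @ \oo --> separator n.
Proof. by rewrite -[n]addn0 separatorD; exact: cvg_separatorD. Qed.

Lemma separator_Mspace2 : Mspace R 2 separator.
Proof.
by apply: (@Mspace2_ell2 _ left_vec right_vec _ 5) => [n|n|//];
  [apply/ell2_norm_le => //; exact: sum_sqn_F
  |apply/ell2_norm_le => //; exact: sum_sqn_G|exact: separatorD].
Qed.

(** At a point [n] within a factor two of the scale of index [l], the other
    scales contribute little: the larger ones because their bumps have hardly
    started, the smaller ones because theirs have decayed.  Each side contributes
    at most [4 / (256 * l.+1)], whence the factor 256 in [scale]. *)
Lemma sum_bump_off (n l P : nat) : (0 < l < P)%N ->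
    (scale l <= n <= 2 * scale l)%N ->
  \sum_(0 <= k < P | k != l) bump (n%:R / u k) <= amp R l / 32.
Proof.
move=> /andP[l0 lP] /andP[nl nu].
have n0 : 0 <= n%:R :> R by [].
have nl' : u l <= n%:R by rewrite ler_nat.
have nu' : n%:R <= 2 * u l by rewrite -natrM ler_nat.
have u0 := @scale_gt0 R.
have -> : \sum_(0 <= k < P | k != l) bump (n%:R / u k) =
    \sum_(0 <= k < l) bump (n%:R / u k) + \sum_(l.+1 <= k < P) bump (n%:R / u k).
  rewrite (@big_cat_nat _ _ _ l) //=; last exact: ltnW.
  rewrite [X in _ + X = _](@big_cat_nat _ _ _ l.+1) //=.
  rewrite [X in _ + (X + _)](_ : _ = 0) ?add0r; last first.
    by rewrite big_mkcond big_nat1 eqxx.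
  by congr (_ + _); rewrite big_nat_cond [RHS]big_nat_cond; apply: eq_bigl => k; lia.
have below : \sum_(0 <= k < l) bump (n%:R / u k) <= 4 / (256 * l.+1%:R).
  case: l l0 {lP nl nu} nl' {nu'} => // l _; rewrite scaleS => nl.
  apply: le_trans (@sum_bump_le R u n%:R 0 l u0 (@scale_double R) n0 _) _ => //.
  set x := n%:R / u l / 2.
  have x_ge : 128 * l.+2%:R <= x.
    rewrite /x !ler_pdivlMr // (le_trans _ nl) //.
    by rewrite le_eqVlt; apply/orP; left; apply/eqP; ring.
  have x0 : 0 < x by apply: lt_le_trans x_ge; rewrite mulr_gt0.
  have ex : expR (- x) <= x^-1.
    by rewrite -[leRHS]mul1r ler_pdivlMr // mulrC; exact: bump_le1.
  have xV : x^-1 <= (128 * l.+2%:R)^-1 by rewrite lef_pV2 ?posrE // mulr_gt0.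
  have -> : 4 / (256 * l.+2%:R) = 2 * (128 * l.+2%:R)^-1 :> R.
    by rewrite ?invfM; move: (l.+2%:R^-1) => r; lra.
  rewrite ler_pM2l // (le_trans _ xV) // (le_trans _ ex) //.
  by rewrite gerBl expR_ge0.
have above : \sum_(l.+1 <= k < P) bump (n%:R / u k) <= 4 / (256 * l.+1%:R).
  have [lP'|] := ltnP l.+1 P; last by move=> ?; rewrite big_geq // divr_ge0.
  case: P lP lP' => // P _ lP'.
  apply: le_trans (@sum_bump_le R u n%:R l.+1 P u0 (@scale_double R) n0 _) _ => //.
  have e1 : expR (- (n%:R / u P / 2)) <= 1.
    by rewrite -expR0 ler_expR oppr_le0 !divr_ge0 // ltW.
  have e2 := expR_ge1Dx (- (n%:R / u l.+1)).
  have e3 : n%:R / u l.+1 <= 2 / (256 * l.+1%:R).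
    rewrite scaleS ler_pdivrMr ?mulr_gt0 // (le_trans nu') //.
    have -> : 2 / (256 * l.+1%:R) * (256 * l.+2%:R * u l) =
        2 * u l * (l.+2%:R / l.+1%:R) :> R.
      by rewrite invfM; move: (l.+1%:R^-1) (l.+2%:R) (u l) => r s v; field.
    rewrite ler_peMr ?mulr_ge0 // ?(ltW (u0 l)) //.
    by rewrite ler_pdivlMr // mul1r ler_nat.
  have -> : 4 / (256 * l.+1%:R) = 2 * (2 / (256 * l.+1%:R)) :> R.
    by rewrite ?invfM; move: (l.+1%:R^-1) => r; lra.
  rewrite ler_pM2l // (le_trans _ e3) // lerBlDr (le_trans e1) //.
  by rewrite -lerBlDl.
apply: le_trans (lerD below above) _.
have := @amp_ge R l.
have -> : 4 / (256 * l.+1%:R) = l.+1%:R^-1 / 64 :> R.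
    by rewrite ?invfM; move: (l.+1%:R^-1) => r; lra.
by move: (l.+1%:R^-1) (amp R l) => r c; lra.
Qed.

Lemma separator_near (n l : nat) : (0 < l)%N -> (scale l <= n <= 2 * scale l)%N ->
  sqn (separator n - sep_term n l) <= (amp R l / 32) ^+ 2.
Proof.
move=> l0 nl.
have cv : (fun P => sqn (\sum_(k < P) sep_term n k - sep_term n l)) @ \oo
    --> sqn (separator n - sep_term n l).
  by apply: cvg_sqn; apply: cvgB; [exact: cvg_separator|exact: cvg_cst].
rewrite -(cvg_lim _ cv) //; apply: limr_le; first exact: cvgP cv.
near=> P; have lP : (l < P)%N by near: P; exact: nbhs_infty_gt.
have d0 : 0 <= amp R l / 32 by rewrite divr_ge0 // ltW // amp_gt0.
rewrite -lecR sqnE rmorphXn ler_pXn2r ?nnegrE ?normr_ge0 ?ler0c //.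
rewrite (bigD1 (Ordinal lP)) //= addrAC subrr add0r.
apply: le_trans (ler_norm_sum _ _ _) _.
have bnd k : `|sep_term n k| <= (bump (n%:R / u k))%:C.
  have b0 : 0 <= bump (n%:R / u k) by rewrite bump_ge0 // divr_ge0 // ltW // scale_gt0.
  rewrite normrM norm_freq mulr1 ger0_norm; last first.
    by rewrite ler0c mulr_ge0 // ltW // amp_gt0.
  by rewrite lecR ler_piMl // amp_le1.
apply: (@le_trans _ _ (\sum_(i < P | i != Ordinal lP) (bump (n%:R / u i))%:C)).
  by apply: ler_sum.
rewrite -rmorph_sum lecR.
by apply: le_trans (sum_bump_off (l := l) (P := P) _ nl); rewrite ?big_mkord ?l0.
Unshelve. all: by end_near. Qed.

Lemma separator_notin_Mspace3 : ~ Mspace R 3 separator.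
Proof.
move=> /Mspace3_bound[K bound].
have [j jK] : exists j : nat, K * 32 < 2 ^+ j.
  exists (Num.bound `|K * 32|); apply: le_lt_trans (ler_norm _) _.
  apply: lt_le_trans (archi_boundP (normr_ge0 _)) _; rewrite -natrX ler_nat.
  exact/ltnW/ltn_expl.
pose N := (16 ^ j)%N; pose z := Num.conj (croot R j).
have N0 : (0 < N)%N by rewrite expn_gt0.
have zN : N.-primitive_root z by rewrite fmorph_primitive_root croot_prim.
pose w (l : 'I_N) := z ^+ (l * scale (N + l)).
have w1 l : `|w l| <= 1 by rewrite normrX (norm_prim_root zN) expr1n.
have := bound N z w (fun l => scale (N + l)) zN w1; apply/negP.
rewrite -real_ltNge ?normr_real //; last first.
  by apply: rpredM; [apply/complex_realP; exists K|rewrite rpredX // realn].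
set S := \sum_(i < N) _.
have term (i l k : 'I_N) : amp R (N + l) / 32 <=
    complex.Re (z ^+ (i * l) * w l * z ^+ (l * k) * separator (i + scale (N + l) + k)).
  set n := (i + scale (N + l) + k)%N.
  have lN : (0 < N + l)%N by rewrite addn_gt0 N0.
  have nl : (scale (N + l) <= n <= 2 * scale (N + l))%N.
    by have := scale_ge (N + l); have := ltn_ord i; have := ltn_ord k; rewrite /n; lia.
  have blk : block (N + l) = j.
    by apply: blockE; rewrite expnS -/N; have := ltn_ord l; lia.
  (* the test coefficient cancels the phase of the dominant term *)
  have q1 : z ^+ (l * n) * freq R (N + l) ^+ n = 1.
    rewrite /freq blk exprD (prim_expr_order (croot_prim R j)) mul1r -exprM.
    by rewrite /z -exprMn mulrC -normCK (norm_prim_root (croot_prim R j)) !expr1n.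
  have -> : z ^+ (i * l) * w l * z ^+ (l * k) = z ^+ (l * n).
    by rewrite /w -!exprD; congr (_ ^+ _); rewrite /n; lia.
  have := separator_near lN nl.
  set d := separator n - _ => dle.
  have -> : separator n = sep_term n (N + l) + d by rewrite /d addrC subrK.
  rewrite mulrDr raddfD /= /sep_term mulrCA q1 mulr1 /=.
  have dq : `|complex.Re (z ^+ (l * n) * d)| <= amp R (N + l) / 32.
    rewrite -(@ler_pXn2r _ 2) ?nnegrE ?normr_ge0 ?divr_ge0 ?(ltW (amp_gt0 R _)) //.
    apply: le_trans dle; have -> : sqn d = sqn (z ^+ (l * n) * d).
      by apply: (@complexI R); rewrite !sqnE normrM normrX (norm_prim_root zN) expr1n mul1r.
    by rewrite real_normK ?num_real // /sqn lerDl sqr_ge0.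
  have big : amp R (N + l) / 16 <= amp R (N + l) * bump (n%:R / u (N + l)%N).
    apply: ler_wpM2l; first exact: ltW (amp_gt0 R _).
    apply: bump_ge; move/andP: nl => [nl nu].
    rewrite ler_pdivlMr ?scale_gt0 // mul1r ler_nat nl /=.
    by rewrite ler_pdivrMr ?scale_gt0 // -natrM ler_nat.
  move: big; have := ler_norm (- complex.Re (z ^+ (l * n) * d)); rewrite normrN.
  by move: dq; lra.
apply: lt_le_trans (normc_ge_Re S).
have ampE (l : 'I_N) : amp R (N + l) = 8^-1 ^+ j.
  rewrite /amp; congr (_ ^+ _).
  by apply: blockE; rewrite expnS -/N; have := ltn_ord l; lia.
have SRe : N%:R ^+ 3 * (8^-1 ^+ j / 32) <= complex.Re S.
  apply: (@le_trans _ _ (\sum_(i < N) \sum_(l < N) \sum_(k < N) (8^-1 ^+ j / 32))).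
    have sumc (c : R) : \sum_(i < N) c = N%:R * c.
      by rewrite sumr_const card_ord mulr_natl.
    rewrite !sumc.
    by rewrite le_eqVlt; apply/orP; left; apply/eqP; ring.
  rewrite /S raddf_sum; apply: ler_sum => i _; rewrite raddf_sum; apply: ler_sum => l _.
  by rewrite raddf_sum; apply: ler_sum => k _; rewrite -(ampE l); exact: term.
rewrite -[N%:R](rmorph_nat (real_complex R)) -rmorphXn -rmorphM ltcR.
apply: lt_le_trans (ler_norm _); apply: lt_le_trans SRe.
have NR : 0 < N%:R :> R by rewrite ltr0n.
rewrite [ltRHS](_ : _ = (2 ^+ j / 32) * N%:R ^+ 2); last first.
  have -> : 2 ^+ j = N%:R * 8^-1 ^+ j :> R.
    by rewrite /N natrX -exprMn; congr (_ ^+ _); field.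
  by move: (8^-1 ^+ j) => c; ring.
by rewrite ltr_pM2r ?exprn_gt0 // ltr_pdivlMr.
Qed.
End Separator.

Theorem theorem2p1 (R : realType) : Mspace R 2 <> Mspace R 3.
Proof.
move=> M23; apply: (@separator_notin_Mspace3 R); rewrite -M23.
exact: separator_Mspace2.
Qed.
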